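(* Let $n, m$ be integers with $n\geq m\geq 2$. Then $$\int_{0}^{\infty}\frac{\sin^{n}x}{x^{m}}\,\mathrm{d}x=\frac{i^{\,m-n+1}}{2^{n}\,(m-1)!}\sum_{\substack{0\le l\le n\\ 2l\neq n}}(-1)^{l}\binom{n}{l}(n-2l)^{m-1}\ln[i(2l-n)].$$
   Context: Here $i$ is the imaginary unit, and for a nonzero real number $a$ the complex logarithm is $\ln[ia]=\ln|a|+i\frac{\pi}{2}\,\mathrm{sign}(a)$, where $\mathrm{sign}(a)=1$ for $a>0$ and $-1$ for $a<0$. The integral on the left is absolutely convergent for $n\ge m\ge 2$. In the sum the term with $2l=n$ (which occurs only for even $n$) is omitted. *)

(* Defs.v *)
From mathcomp Require Import all_boot all_order all_algebra.
From mathcomp Require Import all_classical all_reals all_analysis.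
From mathcomp Require Import complex.

Set Implicit Arguments.
Unset Strict Implicit.
Unset Printing Implicit Defensive.

Import Order.TTheory GRing.Theory Num.Theory.

Local Open Scope ring_scope.
Local Open Scope complex_scope.

(* Principal argument, with values in ]-pi, pi]; the value at 0 is junk. *)
Definition Carg (R : realType) (z : R[i]) : R :=
  let t := acos (complex.Re z / Normc.normc z) in
  if 0 <= complex.Im z then t else - t.

(* Principal branch of the complex logarithm. *)
Definition Clog (R : realType) (z : R[i]) : R[i] :=
  ln (Normc.normc z) +i* Carg z.

(* On the punctured imaginary axis: ln [ia] = ln |a| + i (pi / 2) sign a. *)
Lemma Clog_imaginary (R : realType) (a : R) : a != 0 ->
  Clog ('i * a%:C) = (ln `|a|)%:C + 'i * (pi / 2 * Num.sg a)%:C.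
Proof.
move=> a0; have -> : 'i * a%:C = 0 +i* a by simpc.
rewrite /Clog /Carg /= expr0n /= add0r sqrtr_sqr mul0r acos0.
have [a_ge0|a_lt0] := leP 0 a; simpc.
  by rewrite gtr0_sg ?mulr1// lt0r a0.
by rewrite ltr0_sg// mulrN1.
Qed.

(* Main.v *)
Require Import Defs.
From mathcomp Require Import all_boot all_order all_algebra.
From mathcomp Require Import all_classical all_reals all_analysis.
From mathcomp Require Import complex.
From mathcomp Require Import measurable_realfun.
From mathcomp Require Import ring.

Import Order.TTheory GRing.Theory Num.Theory.
Import numFieldNormedType.Exports.

Local Open Scope classical_set_scope.
Local Open Scope ring_scope.

(** Write [k = m - 1].  Since [1 / x^m] is the Gamma integral of
    [t^k e^(-xt) / k!] over [t > 0], Fubini's theorem turns the integral of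
    [sin^n x / x^m] into [1 / k!] times the integral over [t > 0] of
    [t^k L(t)], where [L] is the Laplace transform of [sin^n]
    ([integral_sin_quotient_laplace]).  Two integrations by parts express
    [L] for [n + 2] through [L] for [n] ([sin_laplace_primitive]), so that [L]
    is the reciprocal of a product of linear factors ([sin_laplace_prod]);
    Newton's formula for iterated differences of [1 / z] ([alt_sum_inv]) is
    its partial fraction expansion

      [L(t) = (2i)^-n sum_l (-1)^l C(n, l) / (t - i (n - 2l))].

    The [n]-th difference of a polynomial of degree less than [n] vanishes
    ([alt_sum_expr]).  This has two consequences for [k < n].  In
    [t^k / (t - y)] the numerator may be replaced by [y^k], because the
    polynomial quotients cancel in the sum ([laplace_partial_fractions]).
    Moreover the residues add up to [0], so that the logarithms occurring in
    the antiderivative cancel at infinity ([log_primitive]).  What remains is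
    the value at infinity of the arctangents and the value at [0] of the
    logarithms: each pole [ia] with residue [K] contributes
    [K (i (pi / 2) sign a - ln |a|)] ([rational_FTC]), which is the summand of
    the theorem since [a = n - 2l] and [ln (-ia) = ln |a| - i (pi / 2) sign a]. *)

(** * Improper integrals from antiderivatives *)

(** Convergence of [F] at infinity yields no Lebesgue integrability; that
    comes from a sign condition or a dominating function in the two lemmas
    below, whereas this predicate is linear in [f] and [v]. *)

Definition improper_primitive {R : realType} (f : R -> R) (v : R) :=
  exists F : R -> R, exists l : R,
    [/\ forall x : R, is_derive x (1:R) F (f x), F x @[x --> +oo] --> l & v = l - F 0].

Lemma improper_primitiveD {R : realType} (f g : R -> R) (u v : R) :
  improper_primitive f u -> improper_primitive g v ->
  improper_primitive (f \+ g) (u + v).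
Proof.
move=> [F [k [dF Fk ->]]] [G [l [dG Gl ->]]].
exists (F \+ G), (k + l); split=> [x||]; last by rewrite /=; ring.
  exact: is_deriveD.
exact: cvgD.
Qed.

Lemma improper_primitiveZ {R : realType} (c : R) (f : R -> R) (u : R) :
  improper_primitive f u -> improper_primitive (fun x => c * f x) (c * u).
Proof.
move=> [F [k [dF Fk ->]]].
exists (fun x => c * F x), (c * k); split=> [x||]; last by ring.
  exact: is_deriveZ.
by apply: cvgM => //; exact: cvg_cst.
Qed.

(** Integrability is part of the conclusion: for a function of constant sign,
    a finite improper integral is a Lebesgue integral. *)
Lemma ge0_improper_FTC {R : realType} (f : R -> R) (v : R) :
  continuous f -> (forall x, 0 < x -> 0 <= f x) -> improper_primitive f v ->
  (@lebesgue_measure R).-integrable `]0, +oo[ (EFin \o f) /\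
  (\int[@lebesgue_measure R]_(x in `]0%R, +oo[) (f x)%:E = v%:E)%E.
Proof.
move=> cf f0 [F [l [dF Fl ->]]].
have f_ge0 x : 0 <= x -> 0 <= f x.
  rewrite le_eqVlt => /predU1P[<-|]; last exact: f0.
  have fr : f y @[y --> (0:R)^'+] --> f 0.
    by apply: cvg_at_right_filter; exact: cf.
  apply: (closed_cvg _ (@closed_ge _ 0) _ _ fr).
  by near=> y; apply: f0; near: y; exact: nbhs_right_gt.
have cF : continuous F.
  move=> x; apply/differentiable_continuous/derivable1_diffP.
  by have [] := dF x.
have mf : measurable_fun (`]0, +oo[ : set R) f.
  by apply: measurable_funTS; exact: continuous_measurable_fun.
have If : (\int[@lebesgue_measure R]_(x in `]0%R, +oo[) (f x)%:E
    = (l - F 0)%:E)%E.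
  rewrite integral_itv_obnd_cbnd ?EFinB; last exact/measurable_EFinP.
  apply: (@ge0_continuous_FTC2y R f F 0 l) => //.
  - apply/continuous_within_itvcyP; split=> [x _|]; first exact: cf.
    by apply: cvg_at_right_filter; exact: cf.
  - by apply: cvg_at_right_filter; exact: cF.
  - by move=> x _; rewrite derive1E; have [] := dF x.
split=> //; apply/integrableP; split; first exact/measurable_EFinP.
under eq_integral => x.
  rewrite inE/= in_itv/= andbT => x0.
  rewrite ger0_norm ?f_ge0 ?ltW//; over.
by rewrite If ltry.
Unshelve. all: by end_near. Qed.

(** Both [g] and [g - f] are nonnegative, and [f = g - (g - f)]. *)
Lemma dominated_improper_FTC {R : realType} (f g : R -> R) (u v : R) :
  continuous f -> continuous g -> (forall x, 0 < x -> `|f x| <= g x) ->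
  improper_primitive f u -> improper_primitive g v ->
  (@lebesgue_measure R).-integrable `]0, +oo[ (EFin \o f) /\
  (\int[@lebesgue_measure R]_(x in `]0%R, +oo[) (f x)%:E = u%:E)%E.
Proof.
move=> cf cg fg pf pg.
have [ig Ig] : (@lebesgue_measure R).-integrable `]0, +oo[ (EFin \o g) /\
    (\int[@lebesgue_measure R]_(x in `]0%R, +oo[) (g x)%:E = v%:E)%E.
  by apply: ge0_improper_FTC => // x /fg; exact: le_trans.
have [ih Ih] : (@lebesgue_measure R).-integrable `]0, +oo[
      (EFin \o (g \+ (fun x => -1 * f x))) /\
    (\int[@lebesgue_measure R]_(x in `]0%R, +oo[)
      ((g \+ (fun x => -1 * f x)) x)%:E = (v + -1 * u)%:E)%E.
  apply: ge0_improper_FTC => [x|x /fg|].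
  - by apply: cvgD; [exact: cg|apply: cvgM; [exact: cvg_cst|exact: cf]].
  - by rewrite ler_norml /= => /andP[_]; rewrite mulN1r subr_ge0.
  - by apply: improper_primitiveD => //; exact: improper_primitiveZ.
have mD : measurable (`]0%R, +oo[ : set (measurableTypeR R)) by [].
have fE x : (f x)%:E = ((g x)%:E - ((g \+ (fun x => -1 * f x)) x)%:E)%E.
  by rewrite -EFinB; congr EFin; rewrite /=; ring.
split.
  have := integrableB mD ig ih; apply: eq_integrable => // x _.
  by rewrite /= fE.
under eq_integral do rewrite fE.
rewrite (integralB mD ig ih) Ig Ih -EFinB; congr EFin; ring.
Qed.

(** * The Gamma integral and the Laplace transform of powers of sine *)

(** The exponential series gives [e^(ax) >= (ax)^(k+1) / (k+1)!], hence the
    bound [(k+1)! / (a^(k+1) x)]. *)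
Lemma cvgy_monomial_expR {R : realType} (k : nat) (a : R) : 0 < a ->
  x ^+ k * expR (- (a * x)) @[x --> +oo] --> (0 : R).
Proof.
move=> a0; set c := k.+1`!%:R / a ^+ k.+1.
have inv0 : c * x^-1 @[x --> +oo] --> (0 : R).
  rewrite -[X in _ --> X](mulr0 c); apply: cvgM; first exact: cvg_cst.
  apply/gtr0_cvgV0; last exact: cvg_id.
  exact: nbhs_pinfty_gt.
apply: (squeeze_cvgr _ (cvg_cst 0) inv0).
near=> x.
have x0 : 0 < x by near: x; exact: nbhs_pinfty_gt.
rewrite mulr_ge0 ?expR_ge0 ?exprn_ge0 ?(ltW x0)//=.
have := @expR_ge1Dxn R (a * x) k (mulr_ge0 (ltW a0) (ltW x0)).
rewrite expRN => h.
rewrite ler_pdivrMr ?expR_gt0//.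
have fact0 : 0 < k.+1`!%:R :> R by rewrite ltr0n fact_gt0.
have le1 : (a * x) ^+ k.+1 / k.+1`!%:R <= expR (a * x).
  by apply: le_trans h; rewrite lerDr.
apply: (@le_trans _ _ (c / x * ((a * x) ^+ k.+1 / k.+1`!%:R))); last first.
  by rewrite ler_wpM2l// /c !mulr_ge0 ?invr_ge0 ?exprn_ge0 // ltW.
rewrite /c exprMn [x ^+ k.+1]exprS le_eqVlt; apply/orP; left; apply/eqP.
by field; rewrite ?expf_neq0 ?lt0r_neq0.
Unshelve. all: by end_near. Qed.

(** Pointwise forms of the derivation rules, with products in place of scalar
    multiplications, so that they unify with explicit antiderivatives. *)
Lemma is_derive_funD {R : realType} {f g : R -> R} {x df dg : R} :
  is_derive x (1:R) f df -> is_derive x (1:R) g dg ->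
  is_derive x (1:R) (fun y => f y + g y) (df + dg).
Proof. exact: is_deriveD. Qed.

Lemma is_derive_funM {R : realType} {f g : R -> R} {x df dg : R} :
  is_derive x (1:R) f df -> is_derive x (1:R) g dg ->
  is_derive x (1:R) (fun y => f y * g y) (df * g x + f x * dg).
Proof.
move=> ff gg; apply: (is_derive_eq (is_deriveM ff gg)).
by rewrite /GRing.scale /=; ring.
Qed.

Lemma is_derive_funX {R : realType} {f : R -> R} (n : nat) {x df : R} :
  is_derive x (1:R) f df ->
  is_derive x (1:R) (fun y => f y ^+ n.+1) (n.+1%:R * f x ^+ n * df).
Proof.
move=> ff; elim: n => [|n IH]; first by apply: is_derive_eq ff _; ring.
have := is_derive_funM ff IH; under eq_fun do rewrite -exprS.
by move/is_derive_eq; apply; rewrite exprS -natr1; ring.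
Qed.

Lemma is_derive_expR_scale {R : realType} (a x : R) :
  is_derive x (1:R) (fun y => expR (- (a * y)) : R) (- a * expR (- (a * x))).
Proof.
have dl : is_derive x (1:R) (fun y : R => - (a * y)) (- a).
  by apply: is_derive_eq; rewrite scaler1.
rewrite mulrC.
exact: (is_derive1_comp (is_derive_expR _) dl).
Qed.

(** One integration by parts lowers [k]. *)
Lemma gamma_primitive {R : realType} (k : nat) (a : R) : 0 < a ->
  improper_primitive (fun x => x ^+ k * expR (- (a * x))) (k`!%:R / a ^+ k.+1).
Proof.
move=> a0; have an0 : a != 0 by rewrite lt0r_neq0.
elim: k => [|k [F [l [dF Fl Fv]]]].
  exists (fun x => - a^-1 * expR (- (a * x))), 0; split=> [x||].
  - have dE := is_derive_expR_scale a x.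
    by apply: is_derive_eq; rewrite /GRing.scale /= expr0; field.
  - rewrite -[X in _ --> X](mulr0 (- a^-1)); apply: cvgM; first exact: cvg_cst.
    have := cvgy_monomial_expR 0 a a0.
    by under eq_fun do rewrite expr0 mul1r.
  - by rewrite mulr0 oppr0 expR0 fact0; field.
exists (fun x => - a^-1 * (x ^+ k.+1 * expR (- (a * x))) + k.+1%:R / a * F x).
exists (- a^-1 * 0 + k.+1%:R / a * l); split=> [x||].
- have dE := is_derive_expR_scale a x; have dFx := dF x.
  have dX := is_derive_funX k (is_derive_id x (1:R)).
  pose dC (c : R) := is_derive_cst c x (1:R).
  apply: (is_derive_eq (is_derive_funD
    (is_derive_funM (dC (- a^-1)) (is_derive_funM dX dE))
    (is_derive_funM (dC (k.+1%:R / a)) dFx))).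
  by rewrite /= exprS; field.
- apply: cvgD; apply: cvgM => //; try exact: cvg_cst.
  exact: cvgy_monomial_expR.
- rewrite expr0n /= mulr0 mul0r mulr0 !add0r -mulrBr -Fv factS natrM exprS.
  by field; rewrite expf_neq0.
Qed.

(** The Laplace transform of [sin^n] at [t]: the recurrence results from two
    integrations by parts, and makes the sign for [t >= 0] evident. *)
Fixpoint sin_laplace {R : realType} (n : nat) (t : R) {struct n} : R :=
  match n with
  | 0 => t^-1
  | 1 => (t ^+ 2 + 1)^-1
  | (p.+1 as q).+1 => q.+1%:R * q%:R / (t ^+ 2 + q.+1%:R ^+ 2) * sin_laplace p t
  end.

Lemma sin_laplace_ge0 {R : realType} (n : nat) (t : R) : 0 <= t ->
  0 <= sin_laplace n t.
Proof.
move=> t0; elim/ltn_ind: n => -[|[|n]] IH /=.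
- by rewrite invr_ge0.
- by rewrite invr_ge0 addr_ge0 ?sqr_ge0.
- by rewrite mulr_ge0 ?divr_ge0 ?addr_ge0 ?sqr_ge0 ?IH.
Qed.

Lemma cvgy_expR_bounded {R : realType} (a M : R) (f : R -> R) : 0 < a ->
  (forall x, `|f x| <= M) -> expR (- (a * x)) * f x @[x --> +oo] --> (0 : R).
Proof.
move=> a0 fM.
have e0 (c : R) : c * expR (- (a * x)) @[x --> +oo] --> (0 : R).
  rewrite -[X in _ --> X](mulr0 c); apply: cvgM; first exact: cvg_cst.
  have := cvgy_monomial_expR 0 a a0.
  by under eq_fun do rewrite expr0 mul1r.
apply: (squeeze_cvgr _ (e0 (- M)) (e0 M)).
apply: nearW => x; have := fM x.
rewrite ler_norml => /andP[fl fu].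
by rewrite [X in _ <= X <= _]mulrC !ler_wpM2r ?expR_ge0.
Qed.

(** The derivative of [e^(-tx) (t sin^(n+2) x + (n+2) sin^(n+1) x cos x)] is
    [e^(-tx) ((n+2) (n+1) sin^n x - (t^2 + (n+2)^2) sin^(n+2) x)]. *)
Lemma sin_laplace_primitive {R : realType} (n : nat) (t : R) : 0 < t ->
  improper_primitive (fun x => expR (- (t * x)) * sin x ^+ n) (sin_laplace n t).
Proof.
move=> t0; have tn0 : t != 0 by rewrite lt0r_neq0.
have t2 (c : R) : t ^+ 2 + c ^+ 2 != 0.
  by rewrite lt0r_neq0// ltr_pwDl ?sqr_ge0 ?exprn_gt0.
have t21 : t ^+ 2 + 1 != 0 by have := t2 1; rewrite expr1n.
elim/ltn_ind: n => -[|[|n]] IH.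
- have [F [l [dF Fl Fv]]] := @gamma_primitive R 0 t t0.
  exists F, l; split=> //; last by rewrite -Fv /= fact0; field.
  by move=> x; have := dF x; rewrite !expr0 mul1r mulr1.
- exists (fun x => - (t ^+ 2 + 1)^-1 * (expR (- (t * x)) * (t * sin x + cos x))), 0.
  split=> [x||].
  + have dE := is_derive_expR_scale t x.
    by apply: is_derive_eq; rewrite /GRing.scale /=; field.
  + rewrite -[X in _ --> X](mulr0 (- (t ^+ 2 + 1)^-1)).
    apply: cvgM; first exact: cvg_cst.
    apply: (cvgy_expR_bounded t (t + 1) _ t0) => x.
    apply: (le_trans (ler_normD _ _)); rewrite lerD ?cos_max//.
    by rewrite normrM gtr0_norm// ler_piMr ?sin_max// ltW.
  + by rewrite /= mulr0 oppr0 expR0 sin0 cos0; field.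
- have [F [l [dF Fl Fv]]] := IH n (ltnW (ltnSn _)).
  exists (fun x => - (t ^+ 2 + n.+2%:R ^+ 2)^-1 *
     (expR (- (t * x)) * (t * sin x ^+ n.+2 + n.+2%:R * (sin x ^+ n.+1 * cos x))) +
     n.+2%:R * n.+1%:R / (t ^+ 2 + n.+2%:R ^+ 2) * F x).
  exists (- (t ^+ 2 + n.+2%:R ^+ 2)^-1 * 0 +
     n.+2%:R * n.+1%:R / (t ^+ 2 + n.+2%:R ^+ 2) * l).
  split=> [x||].
  + have dE := is_derive_expR_scale t x; have dFx := dF x.
    pose dC (c : R) := is_derive_cst c x (1:R).
    have dA := is_derive_funX n.+1 (is_derive_sin x).
    have dB := is_derive_funX n (is_derive_sin x).
    have dS := is_derive_funD (is_derive_funM (dC t) dA)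
      (is_derive_funM (dC n.+2%:R)
        (is_derive_funM dB (is_derive_cos x))).
    apply: (is_derive_eq (is_derive_funD
      (is_derive_funM (dC (- (t ^+ 2 + n.+2%:R ^+ 2)^-1))
        (is_derive_funM dE dS))
      (is_derive_funM
        (dC (n.+2%:R * n.+1%:R / (t ^+ 2 + n.+2%:R ^+ 2))) dFx))).
    have := t2 n.+2%:R.
    rewrite /= !exprS expr0 !mulr1 -[n.+2%:R]natr1.
    move: (n.+1%:R : R) (sin x ^+ n) (cos2Dsin2 x) => N P cs Dn0.
    set S := sin x in cs *; set C := cos x in cs *; set E := expR _.
    (* the two sides differ by a multiple of 1 - (cos^2 + sin^2) *)
    transitivity (E * (S * (S * P)) + P / (t * t + (N + 1) * (N + 1)) * E *
      (N + 1) * N * (1 - (C ^+ 2 + S ^+ 2))); last by rewrite cs subrr mulr0 addr0.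
    by field.
  + apply: cvgD; apply: cvgM; try exact: cvg_cst; last exact: Fl.
    apply: (cvgy_expR_bounded t (t + n.+2%:R) _ t0) => x.
    have sle k : `|sin x ^+ k| <= 1 by rewrite normrX exprn_ile1 ?sin_max.
    apply: (le_trans (ler_normD _ _)); rewrite lerD// normrM.
      by rewrite gtr0_norm// ler_piMr// ltW.
    by rewrite normr_nat ler_piMr// normrM mulr_ile1// cos_max.
  + rewrite sin0 !expr0n /= mul0r !mulr0 addr0 !mulr0 !add0r -mulrBr.
    by rewrite -Fv.
Qed.

(** * Integrals of rational functions with imaginary poles *)

Lemma improper_primitive_sum {R : realType} (I : Type) (r : seq I)
    (P : pred I) (f : I -> R -> R) (v : I -> R) :
  (forall i, P i -> improper_primitive (f i) (v i)) ->
  improper_primitive (fun x => \sum_(i <- r | P i) f i x) (\sum_(i <- r | P i) v i).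
Proof.
move=> pf; elim: r => [|i r IH].
  under eq_fun do rewrite big_nil; rewrite big_nil.
  exists (cst 0), 0; split=> [x||]; last by rewrite subrr.
  - exact: is_derive_cst.
  - exact: cvg_cst.
under eq_fun do rewrite big_cons; rewrite big_cons.
have [Pi|//] := boolP (P i).
exact: improper_primitiveD (pf i Pi) IH.
Qed.

Lemma cvg_sumr {R : realType} (F : set_system R) {FF : Filter F} (I : Type)
    (r : seq I) (P : pred I) (f : I -> R -> R) (l : I -> R) :
  (forall i, P i -> f i x @[x --> F] --> l i) ->
  \sum_(i <- r | P i) f i x @[x --> F] --> \sum_(i <- r | P i) l i.
Proof.
by move=> fl; apply: cvg_big => //; exact: add_continuous.
Qed.

Lemma sqrD_gt0 {R : realType} (a x : R) : a != 0 -> 0 < x ^+ 2 + a ^+ 2.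
Proof. by move=> a0; rewrite ltr_wpDl ?sqr_ge0// exprn_even_gt0. Qed.

Lemma atan_primitive {R : realType} (a : R) : a != 0 ->
  improper_primitive (fun x => a / (x ^+ 2 + a ^+ 2)) (pi / 2 * Num.sg a).
Proof.
move=> a0; exists (fun x => atan (x / a)), (pi / 2 * Num.sg a); split=> [x||].
- have dl : is_derive x (1:R) (fun y : R => y / a) a^-1.
    apply: (is_derive_eq (is_derive_funM (is_derive_id _ _)
      (is_derive_cst a^-1 _ _))).
    by rewrite /=; ring.
  apply: (is_derive_eq (is_derive1_comp (is_derive1_atan _) dl)).
  have x0 : x ^+ 2 + a ^+ 2 != 0 by rewrite lt0r_neq0 ?sqrD_gt0.
  have -> : 1 + (x / a) ^+ 2 = (x ^+ 2 + a ^+ 2) / a ^+ 2.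
    by field.
  by rewrite invf_div; field; rewrite x0.
- have pos (c : R) : 0 < c -> atan (x / c) @[x --> +oo] --> (pi / 2 : R).
    move=> c0; apply: (@cvg_comp _ _ _ (fun x => x / c) (@atan R) _ _ _ _ (@cvgy_atan R)).
    apply: gt0_cvgMly; first by rewrite invr_gt0.
    exact: cvg_id.
  have [an|ap|/eqP] := ltrgtP a 0; last by rewrite (negbTE a0).
  + rewrite ltr0_sg// mulrN1.
    have /pos/cvgN : 0 < - a by rewrite oppr_gt0.
    apply: cvg_trans; apply: near_eq_cvg; apply: nearW => x.
    rewrite -[LHS]/(- atan (x / - a)).
    by rewrite invrN mulrN atanN opprK.
  + by rewrite gtr0_sg// mulr1; exact: pos.
- by rewrite mul0r atan0 subr0.
Qed.

(** Each antiderivative [ln (x^2 + a^2) / 2] diverges like [ln x]; in the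
    combination with coefficients of sum [0] these divergences cancel. *)
Lemma log_primitive {R : realType} (I : Type) (r : seq I) (P : pred I)
    (u a : I -> R) :
  (forall i, P i -> a i != 0) -> \sum_(i <- r | P i) u i = 0 ->
  improper_primitive
    (fun x => \sum_(i <- r | P i) u i * (x / (x ^+ 2 + a i ^+ 2)))
    (- \sum_(i <- r | P i) u i * ln `|a i|).
Proof.
move=> a0 u0.
pose L i x : R := u i * (2^-1 * ln (x ^+ 2 + a i ^+ 2)).
exists (fun x => \sum_(i <- r | P i) L i x), 0; split=> [x||].
- have dL i : P i -> is_derive x (1:R) (L i) (u i * (x / (x ^+ 2 + a i ^+ 2))).
    move=> /a0 ai; have ai0 := sqrD_gt0 _ x ai.
    have dl : is_derive x (1:R) (fun y : R => y ^+ 2 + a i ^+ 2) (2 * x).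
      apply: (is_derive_eq (is_derive_funD
        (is_derive_funX 1 (is_derive_id _ _)) (is_derive_cst _ _ _))).
      by rewrite /= expr1; ring.
    have dln : is_derive x (1:R) (fun y => ln (y ^+ 2 + a i ^+ 2) : R)
        ((x ^+ 2 + a i ^+ 2)^-1 * (2 * x)).
      exact: (@is_derive1_comp _ _ (fun y => y ^+ 2 + a i ^+ 2) _ _ _
        (is_derive1_ln ai0) dl).
    have dL := is_derive_funM (is_derive_cst (u i) x (1:R))
      (is_derive_funM (is_derive_cst (2^-1:R) x (1:R)) dln).
    apply: (is_derive_eq dL).
    by rewrite /=; field; rewrite lt0r_neq0.
  elim: r {u0} => [|i r IH].
    by under eq_fun do rewrite big_nil; rewrite big_nil; exact: is_derive_cst.
  under eq_fun do rewrite big_cons; rewrite big_cons.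
  have [Pi|//] := boolP (P i).
  exact: is_derive_funD (dL i Pi) IH.
- have l0 i : P i ->
      u i * (2^-1 * ln (1 + a i ^+ 2 * (x^-1) ^+ 2)) @[x --> +oo] --> (0 : R).
    move=> /a0 ai.
    have xV : x^-1 @[x --> +oo] --> (0 : R).
      apply/gtr0_cvgV0; last exact: cvg_id.
      exact: nbhs_pinfty_gt.
    have lim1 : 1 + a i ^+ 2 * (x^-1) ^+ 2 @[x --> +oo] --> (1 : R).
      rewrite -[X in _ --> X](addr0 (1:R)); apply: cvgD; first exact: cvg_cst.
      rewrite -[X in _ --> X](mulr0 (a i ^+ 2)); apply: cvgM; first exact: cvg_cst.
      rewrite -[X in _ --> X](mulr0 (0:R)); under eq_fun do rewrite expr2.
      exact: cvgM.
    rewrite -[X in _ --> X](mulr0 (u i)); apply: cvgM; first exact: cvg_cst.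
    rewrite -[X in _ --> X](mulr0 (2^-1)); apply: cvgM; first exact: cvg_cst.
    rewrite -[X in _ --> X](@ln1 R).
    exact: (continuous_cvg _ (continuous_ln ltr01) lim1).
  have S0 : \sum_(i <- r | P i) u i * (2^-1 * ln (1 + a i ^+ 2 * (x^-1) ^+ 2))
      @[x --> +oo] --> (0 : R).
    rewrite [X in _ --> X](_ : 0 = \sum_(i <- r | P i) 0); last by rewrite big1.
    exact: cvg_sumr.
  apply: cvg_trans S0; apply: near_eq_cvg; near=> x.
  have x0 : 0 < x by near: x; exact: nbhs_pinfty_gt.
  (* the coefficients add up to 0, so ln x may be subtracted from each logarithm *)
  transitivity (\sum_(i <- r | P i) (L i x - u i * ln x)).
    apply: eq_bigr => i /a0 ai; rewrite /L.
    have -> : x ^+ 2 + a i ^+ 2 = (1 + a i ^+ 2 * x^-1 ^+ 2) * x ^+ 2.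
      by field; rewrite lt0r_neq0.
    rewrite lnM ?posrE ?exprn_gt0//; last first.
      by rewrite ltr_pwDl// mulr_ge0 ?sqr_ge0.
    by rewrite lnXn// -mulr_natr; field.
  by rewrite sumrB -mulr_suml u0 mul0r subr0.
- rewrite sub0r; congr (- _); apply: eq_bigr => i /a0 ai.
  rewrite /L expr0n /= add0r -[a i ^+ 2]real_normK ?num_real//.
  by rewrite lnXn ?normr_gt0// -mulr_natr; field.
Unshelve. all: by end_near. Qed.

(** The summand of [h] is the real part of [(u + i v) / (x - i a)].  Applied to
    [(v, - u)] instead of [(u, v)], the lemma deals with the imaginary parts. *)
Lemma rational_FTC {R : realType} (I : Type) (r : seq I) (P : pred I)
    (u v a : I -> R) (h : R -> R) :
  (forall i, P i -> a i != 0) -> \sum_(i <- r | P i) u i = 0 ->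
  (forall x, 0 < x ->
    h x = \sum_(i <- r | P i) (u i * x - v i * a i) / (x ^+ 2 + a i ^+ 2)) ->
  (forall x, 0 < x -> 0 <= h x) ->
  (\int[@lebesgue_measure R]_(x in `]0%R, +oo[) (h x)%:E =
   (- \sum_(i <- r | P i) (u i * ln `|a i| + v i * (pi / 2 * Num.sg (a i))))%:E)%E.
Proof.
move=> a0 u0 hE h0.
pose g (x : R) := \sum_(i <- r | P i) u i * (x / (x ^+ 2 + a i ^+ 2)) +
   \sum_(i <- r | P i) - v i * (a i / (x ^+ 2 + a i ^+ 2)).
have gE x : 0 < x -> h x = g x.
  move=> x0; rewrite hE// /g -big_split; apply: eq_bigr => i _ /=; ring.
have pg : improper_primitive g
    (- \sum_(i <- r | P i) (u i * ln `|a i| + v i * (pi / 2 * Num.sg (a i)))).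
  rewrite big_split opprD/=; apply: improper_primitiveD.
    exact: log_primitive.
  rewrite -sumrN; under eq_bigr do rewrite -mulNr.
  apply: improper_primitive_sum => i /a0 ai.
  by apply: improper_primitiveZ; exact: atan_primitive.
have cg : continuous g.
  have c1 i : P i -> continuous (fun x : R => (x ^+ 2 + a i ^+ 2)^-1).
    move=> /a0 ai x; apply: cvgV; first by rewrite lt0r_neq0 ?sqrD_gt0.
    by apply: cvgD; [exact: exprn_continuous|exact: cvg_cst].
  move=> x; apply: cvgD; apply: cvg_sumr => i Pi;
    (apply: cvgM; first exact: cvg_cst); apply: cvgM;
    by [exact: cvg_id|exact: cvg_cst|exact: c1].
have g0 x : 0 < x -> 0 <= g x by move=> x0; rewrite -gE// h0.
have [_ <-] := ge0_improper_FTC g _ cg g0 pg.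
apply: eq_integral => x; rewrite inE/= in_itv/= andbT => x0.
by rewrite gE.
Qed.

(** * Exchange of the order of integration *)

(** Fubini's theorem on the plane, for the extension of [f] by [0] outside
    [A `*` B]. *)
Lemma Fubini_setX {R : realType} (A B : set R) (f : R * R -> R) :
  measurable A -> measurable B -> measurable_fun [set: R * R] f ->
  (\int[@lebesgue_measure R]_(x in A) \int[@lebesgue_measure R]_(y in B)
     `|f (x, y)|%:E < +oo)%E ->
  (\int[@lebesgue_measure R]_(x in A) \int[@lebesgue_measure R]_(y in B)
     (f (x, y))%:E =
   \int[@lebesgue_measure R]_(y in B) \int[@lebesgue_measure R]_(x in A)
     (f (x, y))%:E)%E.
Proof.
move=> mA mB mf foo.
pose F (g : R * R -> R) := ((EFin \o g) \_ (A `*` B)).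
have FE1 g : (fun x => \int[@lebesgue_measure R]_y F g (x, y))%E =
    ((fun x => \int[@lebesgue_measure R]_(y in B) (g (x, y))%:E) \_ A)%E.
  apply/funext => x; rewrite patchE; case: ifPn => xA.
    rewrite [RHS]integral_mkcond; apply: eq_integral => y _.
    rewrite /F !patchE; congr (if _ then _ else _).
    apply/idP/idP; rewrite !inE /=; first by case.
    by move=> yB; split=> //; rewrite inE in xA.
  apply: integral0_eq => y _; rewrite /F patchE; case: ifPn => //.
  by rewrite inE /= => -[xA' _]; move: xA; rewrite notin_setE.
have FE2 g : (fun y => \int[@lebesgue_measure R]_x F g (x, y))%E =
    ((fun y => \int[@lebesgue_measure R]_(x in A) (g (x, y))%:E) \_ B)%E.
  apply/funext => y; rewrite patchE; case: ifPn => yB.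
    rewrite [RHS]integral_mkcond; apply: eq_integral => x _.
    rewrite /F !patchE; congr (if _ then _ else _).
    apply/idP/idP; rewrite !inE /=; first by case.
    by move=> xA; split=> //; rewrite inE in yB.
  apply: integral0_eq => x _; rewrite /F patchE; case: ifPn => //.
  by rewrite inE /= => -[_ yB']; move: yB; rewrite notin_setE.
have mF : measurable_fun [set: R * R] (F f).
  apply/(measurable_restrictT _ _).1; first exact: measurableX.
  by apply: measurable_funTS; exact/measurable_EFinP.
rewrite [LHS]integral_mkcond [RHS]integral_mkcond -FE1 -FE2.
apply: Fubini; apply/integrable12ltyP => //.
move: foo; rewrite integral_mkcond -(FE1 (fun z => `|f z|)).
congr (_ < _)%E; apply: eq_integral => x _; apply: eq_integral => y _.
by rewrite /F !patchE; case: ifPn; rewrite //= normr0.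
Qed.

Lemma normr_sin_le {R : realType} (x : R) : 0 <= x -> `|sin x| <= x.
Proof.
rewrite le_eqVlt => /predU1P[<-|x0]; first by rewrite sin0 normr0.
have [|c _] := @MVT R sin cos 0 x x0 (fun y _ => is_derive_sin y).
  by apply: continuous_subspaceT; exact: continuous_sin.
rewrite sin0 !subr0 => ->.
by rewrite normrM (gtr0_norm x0) ler_piMl ?cos_max ?ltW.
Qed.

Lemma continuous_sinX {R : realType} (n : nat) :
  continuous (fun x : R => sin x ^+ n).
Proof.
move=> x; apply: (@continuous_comp _ _ _ (@sin R) (fun y => y ^+ n)).
  exact: continuous_sin.
exact: exprn_continuous.
Qed.

Lemma continuous_expR_scale {R : realType} (a : R) :
  continuous (fun x : R => expR (- (a * x))).
Proof.
move=> x; apply: (@continuous_comp _ _ _ (fun y : R => - (a * y)) (@expR R)).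
  by apply: cvgN; apply: cvgM; [exact: cvg_cst|exact: cvg_id].
exact: continuous_expR.
Qed.

Lemma measurable_fun_sin_quotient {R : realType} (n m : nat) :
  measurable_fun (`]0, +oo[ : set R) (fun x : R => sin x ^+ n / x ^+ m).
Proof.
apply: open_continuous_measurable_fun; first exact: interval_open.
move=> x; rewrite inE/= in_itv/= andbT => x0.
apply: cvgM; first exact: continuous_sinX.
apply: cvgV; first by rewrite expf_neq0 ?lt0r_neq0.
exact: exprn_continuous.
Qed.

(** [|sin x| / x] is at most [1] and at most [1 / x], so its square [q]
    satisfies [q (x^2 + 1) <= 2]; larger exponents only decrease the quotient.
    The exponent on [1] is kept to match [atan_primitive]. *)
Lemma sin_quotient_le {R : realType} (n m : nat) (x : R) :
  (2 <= m)%N -> (m <= n)%N -> 0 < x ->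
  `|sin x ^+ n / x ^+ m| <= 2 * (1 / (x ^+ 2 + 1 ^+ 2)).
Proof.
move=> m2 mn x0.
have x2 : 0 < x ^+ 2 + 1 ^+ 2 by rewrite sqrD_gt0 ?oner_neq0.
have q0 : 0 <= `|sin x| / x by rewrite divr_ge0// ltW.
have q1 : `|sin x| / x <= 1 by rewrite ler_pdivrMr// mul1r normr_sin_le// ltW.
apply: (@le_trans _ _ ((`|sin x| / x) ^+ 2)).
  apply: (@le_trans _ _ ((`|sin x| / x) ^+ m)); last by rewrite ler_wiXn2l.
  rewrite normrM normfV !normrX (gtr0_norm x0) exprMn exprVn.
  by rewrite ler_wpM2r ?invr_ge0 ?exprn_ge0 ?(ltW x0)// ler_wiXn2l ?sin_max.
rewrite mul1r ler_pdivlMr// mulrDr expr1n mulr1 expr_div_n.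
rewrite divfK ?expf_neq0 ?lt0r_neq0// -expr_div_n [2]/(1 + 1) lerD//.
  by rewrite exprn_ile1 ?sin_max.
by rewrite exprn_ile1.
Qed.

Lemma integrable_sin_quotient {R : realType} (n m : nat) :
  (2 <= m)%N -> (m <= n)%N ->
  (@lebesgue_measure R).-integrable `]0, +oo[
    (fun x : R => (sin x ^+ n / x ^+ m)%:E).
Proof.
move=> m2 mn.
have pg : improper_primitive (fun x : R => 2 * (1 / (x ^+ 2 + 1 ^+ 2)))
    (2 * (pi / 2 * Num.sg 1)).
  by apply: improper_primitiveZ; apply: atan_primitive; exact: oner_neq0.
have [||ig _] := ge0_improper_FTC _ _ _ _ pg.
- move=> x; apply: cvgM; first exact: cvg_cst.
  apply: cvgM; first exact: cvg_cst.
  apply: cvgV; first by rewrite lt0r_neq0 ?sqrD_gt0 ?oner_neq0.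
  by apply: cvgD; [exact: exprn_continuous|exact: cvg_cst].
- by move=> x x0; rewrite mulr_ge0// divr_ge0// ltW ?sqrD_gt0 ?oner_neq0.
have mD : measurable (`]0%R, +oo[ : set (measurableTypeR R)) by [].
apply: (le_integrable mD _ _ ig).
  apply/measurable_EFinP; exact: measurable_fun_sin_quotient.
move=> x; rewrite /= in_itv/= andbT => x0.
by rewrite lee_fin (le_trans (sin_quotient_le _ _ _ m2 mn x0))// ler_norm.
Qed.

(** Fubini's theorem for [sin^n x t^k e^(-xt)].  The inner integral over [t] of
    its absolute value is [k! |sin^n x| / x^(k+1)], so absolute convergence on
    the quadrant is the integrability of [sin^n x / x^(k+1)]. *)
Lemma integral_sin_quotient_laplace {R : realType} (n k : nat) :
  (1 <= k)%N -> (k.+1 <= n)%N ->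
  (\int[@lebesgue_measure R]_(x in `]0%R, +oo[)
     (k`!%:R * (sin x ^+ n / x ^+ k.+1))%:E =
   \int[@lebesgue_measure R]_(t in `]0%R, +oo[) (t ^+ k * sin_laplace n t)%:E)%E.
Proof.
move=> k1 kn.
pose f (z : R * R) := sin z.1 ^+ n * (z.2 ^+ k * expR (- (z.1 * z.2))).
have mD : measurable (`]0%R, +oo[ : set (measurableTypeR R)) by [].
have mf : measurable_fun [set: R * R] f.
  have m1 : measurable_fun [set: R * R] fst by exact: measurable_fst.
  have m2 : measurable_fun [set: R * R] snd by exact: measurable_snd.
  apply: measurable_funM.
    apply: measurable_funX; apply: measurableT_comp m1.
    by apply: continuous_measurable_fun; exact: continuous_sin.
  apply: measurable_funM; first exact: measurable_funX.
  apply: measurableT_comp => //; apply: measurableT_comp => //.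
  exact: measurable_funM.
have gamma x : 0 < x ->
    (@lebesgue_measure R).-integrable `]0, +oo[
      (EFin \o (fun t => t ^+ k * expR (- (x * t)))) /\
    (\int[@lebesgue_measure R]_(t in `]0%R, +oo[) (t ^+ k * expR (- (x * t)))%:E
     = (k`!%:R / x ^+ k.+1)%:E)%E.
  move=> x0; apply: ge0_improper_FTC; last exact: gamma_primitive.
    move=> t; apply: cvgM; first exact: exprn_continuous.
    exact: continuous_expR_scale.
  by move=> t t0; rewrite mulr_ge0 ?expR_ge0 ?exprn_ge0 ?ltW.
transitivity (\int[@lebesgue_measure R]_(x in `]0%R, +oo[)
    \int[@lebesgue_measure R]_(t in `]0%R, +oo[) (f (x, t))%:E)%E.
  apply: eq_integral => x; rewrite inE/= in_itv/= andbT => x0.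
  have [ig Ig] := gamma x x0.
  rewrite /f /=; under eq_integral do rewrite EFinM.
  by rewrite (integralZl mD ig) Ig -EFinM; congr EFin; ring.
rewrite Fubini_setX//.
  apply: eq_integral => t; rewrite inE/= in_itv/= andbT => t0.
  (* the dominating function e^(-tx) is the integrand for the exponent 0 *)
  have [] := @dominated_improper_FTC R (fun x => expR (- (t * x)) * sin x ^+ n)
    (fun x => expR (- (t * x)) * sin x ^+ 0) (sin_laplace n t) (sin_laplace 0 t).
  - move=> x; apply: cvgM; first exact: continuous_expR_scale.
    exact: continuous_sinX.
  - move=> x; under eq_fun do rewrite expr0 mulr1.
    exact: continuous_expR_scale.
  - move=> x x0; rewrite expr0 mulr1 normrM gtr0_norm ?expR_gt0//.
    by rewrite ler_piMr ?expR_ge0// normrX exprn_ile1 ?sin_max.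
  - exact: sin_laplace_primitive.
  - exact: sin_laplace_primitive.
  move=> iL IL; rewrite EFinM -IL -(integralZl mD iL).
  by apply: eq_integral => x _; rewrite /f /= -EFinM; congr EFin;
    rewrite [x * t]mulrC; ring.
have /integrableP[_] :=
  integrableZl mD k`!%:R (integrable_sin_quotient n k.+1 k1 kn).
congr (_ < _)%E; apply: eq_integral => x; rewrite inE/= in_itv/= andbT => x0.
have [ig Ig] := gamma x x0.
transitivity (\int[@lebesgue_measure R]_(t in `]0%R, +oo[)
    (`|sin x ^+ n|%:E * (t ^+ k * expR (- (x * t)))%:E))%E.
  rewrite (integralZl mD ig) Ig -!EFinM; congr EFin.
  rewrite !normrM normfV normr_nat (normrX _ x) (gtr0_norm x0); ring.
apply: eq_integral => t; rewrite inE/= in_itv/= andbT => t0.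
rewrite -EFinM /f /= normrM [X in _ = (_ * X)%:E]ger0_norm//.
by rewrite mulr_ge0 ?expR_ge0// exprn_ge0// ltW.
Qed.

(** * Iterated differences and partial fractions *)

Local Open Scope complex_scope.

(** Up to the sign [(-1)^n], the [n]-th forward difference of [f] at [0]. *)
Definition alt_sum {V : fieldType} (n : nat) (f : nat -> V) : V :=
  \sum_(0 <= l < n.+1) (-1) ^+ l * 'C(n, l)%:R * f l.

(** Pascal's rule. *)
Lemma alt_sumS {V : fieldType} (n : nat) (f : nat -> V) :
  alt_sum n.+1 f = alt_sum n f - alt_sum n (f \o succn).
Proof.
rewrite /alt_sum big_nat_recl//= bin0.
under eq_bigr do rewrite binS natrD mulrDr mulrDl.
rewrite big_split/= addrA; congr (_ + _); last first.
  by rewrite -sumrN; apply: eq_bigr => l _; rewrite exprS; ring.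
transitivity (\sum_(0 <= l < n.+2) (-1) ^+ l * 'C(n, l)%:R * f l).
  by rewrite [RHS]big_nat_recl// bin0.
by rewrite big_nat_recr//= bin_small// mulr0 mul0r addr0.
Qed.

Lemma eq_alt_sum {V : fieldType} (n : nat) (f g : nat -> V) :
  (forall l, (l <= n)%N -> f l = g l) -> alt_sum n f = alt_sum n g.
Proof.
by move=> fg; apply: eq_big_nat => l /andP[_ ln]; rewrite fg.
Qed.

Lemma alt_sumZ {V : fieldType} (n : nat) (c : V) (f : nat -> V) :
  alt_sum n (fun l => c * f l) = c * alt_sum n f.
Proof. by rewrite /alt_sum mulr_sumr; apply: eq_bigr => l _; ring. Qed.

Lemma alt_sumD {V : fieldType} (n : nat) (f g : nat -> V) :
  alt_sum n (fun l => f l + g l) = alt_sum n f + alt_sum n g.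
Proof. by rewrite /alt_sum -big_split; apply: eq_bigr => l _; rewrite mulrDr. Qed.

Lemma alt_sum_sum {V : fieldType} (n k : nat) (f : 'I_k -> nat -> V) :
  alt_sum n (fun l => \sum_(j < k) f j l) = \sum_(j < k) alt_sum n (f j).
Proof.
rewrite /alt_sum exchange_big; apply: eq_bigr => l _ /=.
by rewrite mulr_sumr.
Qed.

(** A difference of step [b] lowers the degree: [(z + b)^k - z^k] is a
    combination of the [z^j] with [j < k]. *)
Lemma alt_sum_expr {V : fieldType} (n k : nat) (w b : V) : (k < n)%N ->
  alt_sum n (fun l => (w + l%:R * b) ^+ k) = 0.
Proof.
elim: n k => // n IH k; rewrite ltnS => kn.
rewrite alt_sumS; apply/eqP; rewrite subr_eq0 eq_sym; apply/eqP.
have -> : alt_sum n ((fun l => (w + l%:R * b) ^+ k) \o succn) =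
   alt_sum n (fun l => (w + l%:R * b) ^+ k +
     \sum_(j < k) (b ^+ (k - j) * 'C(k, j)%:R) * (w + l%:R * b) ^+ j).
  apply: eq_alt_sum => l _ /=.
  have -> : w + l.+1%:R * b = b + (w + l%:R * b) by rewrite -natr1; ring.
  rewrite exprDn big_ord_recr /= subnn expr0 mul1r binn mulr1n addrC.
  congr (_ + _); apply: eq_bigr => j _.
  by rewrite -[_ *+ _]mulr_natr; ring.
rewrite alt_sumD alt_sum_sum big1 ?addr0// => j _.
by rewrite alt_sumZ IH ?mulr0// (leq_trans (ltn_ord j)).
Qed.

(** By Pascal's rule and induction, the sum is a difference of two inverse
    products that share all but their end factors [w] and [w + (n+1) b]; over
    the common denominator the numerator gains [(w + (n+1) b) - w = (n+1) b]. *)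
Lemma alt_sum_inv {V : fieldType} (n : nat) (w b : V) :
  (forall l, (l <= n)%N -> w + l%:R * b != 0) ->
  alt_sum n (fun l => (w + l%:R * b)^-1) =
  n`!%:R * b ^+ n / \prod_(0 <= l < n.+1) (w + l%:R * b).
Proof.
elim: n w => [|n IH] w wb0.
  by rewrite /alt_sum !big_nat1 fact0 bin0 !expr0 !mul1r.
have shift l : w + l.+1%:R * b = w + b + l%:R * b by rewrite -natr1; ring.
rewrite alt_sumS IH; last by move=> l ln; rewrite wb0// (leq_trans ln).
have -> : alt_sum n ((fun l => (w + l%:R * b)^-1) \o succn) =
    alt_sum n (fun l => (w + b + l%:R * b)^-1).
  by apply: eq_alt_sum => l _ /=; rewrite shift.
rewrite IH; last by move=> l ln; rewrite -shift wb0.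
have P0 : \prod_(0 <= l < n.+1) (w + l%:R * b) =
    w * \prod_(0 <= l < n) (w + b + l%:R * b).
  rewrite big_nat_recl// mul0r addr0; congr (_ * _).
  by apply: eq_bigr => l _; rewrite shift.
have PS : \prod_(0 <= l < n.+2) (w + l%:R * b) =
    w * (\prod_(0 <= l < n) (w + b + l%:R * b) * (w + b + n%:R * b)).
  rewrite big_nat_recl// mul0r addr0; congr (_ * _).
  by rewrite big_nat_recr//= ; under eq_bigr do rewrite shift; rewrite shift.
rewrite P0 PS [X in _ - _ / X]big_nat_recr//=.
have w0 : w != 0 by have := wb0 0%N isT; rewrite mul0r addr0.
have wn0 : w + b + n%:R * b != 0 by rewrite -shift wb0.
have Q0 : \prod_(0 <= l < n) (w + b + l%:R * b) != 0.
  rewrite prodf_seq_neq0; apply/allP => l; rewrite mem_index_iota => /andP[_ ln].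
  by rewrite -shift wb0// ltnS ltnW.
rewrite factS natrM -natr1 exprS.
by field; rewrite Q0 wn0 w0.
Qed.

Section laplace_partial_fractions.
Context {R : realType}.
Implicit Types (t : R) (n k l : nat).

(** The frequencies of [sin^n]: it is a combination of the exponentials
    [e^(i (n - 2l) x)], and its Laplace transform has its poles at
    [i (n - 2l)]. *)
Definition freq n l : R := n%:R - 2 * l%:R.

Let C := R[i].

Lemma sqr_iC : 'i * 'i = -1 :> C.
Proof. by rewrite -expr2 sqr_i. Qed.

Lemma subr_imag_neq0 t (a : R) : 0 < t -> t%:C - 'i * a%:C != 0.
Proof.
move=> t0; rewrite eq_complex negb_and; apply/orP; left.
by simpc; rewrite /= ?mul0r ?mul1r ?subr0 lt0r_neq0.
Qed.

Lemma freqE t n l : t%:C - 'i * (freq n l)%:C =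
  t%:C - 'i * n%:R + l%:R * (2 * 'i).
Proof.
by rewrite /freq rmorphB rmorphM !rmorph_nat /=; ring.
Qed.

Lemma mul_conj_factors t (a : R) :
  (t%:C - 'i * a%:C) * (t%:C - 'i * (- a)%:C) = (t ^+ 2 + a ^+ 2)%:C.
Proof.
rewrite rmorphN rmorphD !rmorphXn /=.
transitivity (t%:C ^+ 2 - ('i * 'i) * a%:C ^+ 2); first by ring.
by rewrite sqr_iC; ring.
Qed.

Lemma sin_laplaceSS n t : sin_laplace n.+2 t =
  n.+2%:R * n.+1%:R / (t ^+ 2 + n.+2%:R ^+ 2) * sin_laplace n t.
Proof. by []. Qed.

(** Passing from [n] to [n + 2] adds the two frequencies [n + 2] and
    [- (n + 2)], whose factors multiply to [t^2 + (n + 2)^2]. *)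
Lemma sin_laplace_prod n t : 0 < t ->
  (sin_laplace n t)%:C =
  n`!%:R / \prod_(0 <= l < n.+1) (t%:C - 'i * (freq n l)%:C).
Proof.
move=> t0; elim/ltn_ind: n => -[|[|n]] IH.
- rewrite big_nat1 fact0 /freq mulr0 subr0 mulr0 subr0 mul1r /=.
  exact: fmorphV.
- rewrite big_nat_recr//= big_nat1.
  have -> : freq 1 1 = - freq 1 0 by rewrite /freq; ring.
  by rewrite mul_conj_factors /freq mulr0 subr0 expr1n fmorphV mul1r.
- have IHn := IH n (ltnW (ltnSn _)).
  rewrite sin_laplaceSS rmorphM /= IHn.
  rewrite [X in _ = _ / X]big_nat_recr// [X in _ = _ / (X * _)]big_nat_recl//=.
  have -> : \prod_(0 <= i < n.+1) (t%:C - 'i * (freq n.+2 i.+1)%:C) =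
      \prod_(0 <= i < n.+1) (t%:C - 'i * (freq n i)%:C).
    apply: eq_bigr => l _; congr (_ - _ * _%:C).
    by rewrite /freq -!natr1; ring.
  set P := \prod_(_ <= _ < _) _.
  have P0 : P != 0.
    rewrite prodf_seq_neq0; apply/allP => l _ /=.
    exact: subr_imag_neq0.
  have -> : freq n.+2 n.+2 = - freq n.+2 0 by rewrite /freq; ring.
  rewrite [X in _ = _ / X]mulrAC mul_conj_factors /freq mulr0 subr0.
  have D0 : (t ^+ 2 + n.+2%:R ^+ 2)%:C != 0 :> C.
    by rewrite fmorph_eq0 lt0r_neq0// ltr_pwDl ?sqr_ge0 ?exprn_gt0.
  rewrite rmorphM fmorphV rmorphM !rmorph_nat !factS !natrM.
  field; rewrite P0 /=; move: D0.
  by rewrite rmorphD !rmorphXn rmorph_nat -[n.+2]add2n natrD.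
Qed.

Lemma alt_sum_freq n k : (k < n)%N ->
  alt_sum n (fun l => ('i * (freq n l)%:C) ^+ k) = 0 :> C.
Proof.
move=> kn; rewrite -(@alt_sum_expr C n k ('i * n%:R) (- (2 * 'i)) kn).
apply: eq_alt_sum => l _; congr (_ ^+ _).
by rewrite /freq rmorphB rmorphM !rmorph_nat /=; ring.
Qed.

(** The residue of [t^k L(t)] at the pole [i (n - 2l)]. *)
Definition residue n k l : C :=
  (2 * 'i) ^- n * ((-1) ^+ l * 'C(n, l)%:R * ('i * (freq n l)%:C) ^+ k).

(** For [2l = n] the residue is [0] because [k > 0]. *)
Lemma sum_residue n k (g : nat -> C) : (0 < k)%N ->
  \sum_(0 <= l < n.+1 | (2 * l != n)%N) residue n k l * g l =
  (2 * 'i) ^- n * alt_sum n (fun l => ('i * (freq n l)%:C) ^+ k * g l).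
Proof.
move=> k0; rewrite /alt_sum mulr_sumr big_mkcond; apply: eq_bigr => l _.
case: ifPn => [_|]; first by rewrite /residue; ring.
rewrite negbK => /eqP nl.
have -> : freq n l = 0 by rewrite /freq -nl natrM subrr.
by rewrite mulr0 expr0n -[k == 0%N]negbK -lt0n k0 !(mul0r, mulr0).
Qed.

Lemma sum_residue0 n k : (0 < k)%N -> (k < n)%N ->
  \sum_(0 <= l < n.+1 | (2 * l != n)%N) residue n k l = 0.
Proof.
move=> k0 kn; have := @sum_residue n k (fun=> 1) k0.
under eq_bigr do rewrite mulr1; move=> ->.
by under eq_fun do rewrite mulr1; rewrite alt_sum_freq ?mulr0.
Qed.

(** With [y] a pole, [t^k / (t - y)] equals [y^k / (t - y)] plus a polynomial
    of degree less than [k] in [y], which the [n]-th difference annihilates. *)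
Lemma laplace_partial_fractions n k t : (0 < k)%N -> (k < n)%N -> 0 < t ->
  (t ^+ k * sin_laplace n t)%:C =
  \sum_(0 <= l < n.+1 | (2 * l != n)%N)
    residue n k l / (t%:C - 'i * (freq n l)%:C).
Proof.
move=> k0 kn t0.
have i20 : (2 * 'i : C) != 0.
  by rewrite mulf_neq0 ?pnatr_eq0// eq_complex/= oner_eq0 andbF.
have neq0 l : t%:C - 'i * (freq n l)%:C != 0 by exact: subr_imag_neq0.
pose y l : C := 'i * (freq n l)%:C.
have LE : (sin_laplace n t)%:C =
    (2 * 'i) ^- n * alt_sum n (fun l => (t%:C - y l)^-1).
  rewrite sin_laplace_prod//.
  rewrite (@eq_alt_sum _ _ _ (fun l => (t%:C - 'i * n%:R + l%:R * (2 * 'i))^-1)).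
    rewrite alt_sum_inv; last by move=> l _; rewrite -freqE.
    under [in RHS]eq_bigr do rewrite -freqE.
    rewrite mulrA mulrCA mulVf ?mulr1 ?expf_neq0//.
  by move=> l _; rewrite -freqE.
rewrite rmorphM rmorphXn /= LE mulrCA -alt_sumZ.
have -> : alt_sum n (fun l => t%:C ^+ k * (t%:C - y l)^-1) =
    alt_sum n (fun l => y l ^+ k * (t%:C - y l)^-1 +
      \sum_(j < k) t%:C ^+ (k.-1 - j) * y l ^+ j).
  apply: eq_alt_sum => l _.
  apply/(mulfI (neq0 l)); rewrite mulrDr -[_ * \sum_(_ < _) _]subrXX.
  by rewrite ![_ * (_ * _^-1)]mulrC !mulfVK ?neq0// addrC subrK.
rewrite alt_sumD alt_sum_sum big1 ?addr0; last first.
  move=> j _; rewrite alt_sumZ alt_sum_freq ?mulr0//.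
  exact: ltn_trans (ltn_ord j) kn.
by rewrite sum_residue.
Qed.

End laplace_partial_fractions.

(** * The integral *)

Lemma div_imag_shift {R : realType} (z : R[i]) (t a : R) : 0 < t ->
  z / (t%:C - 'i * a%:C) =
  ((complex.Re z * t - complex.Im z * a) / (t ^+ 2 + a ^+ 2)) +i*
  ((complex.Im z * t + complex.Re z * a) / (t ^+ 2 + a ^+ 2)).
Proof.
move=> t0; have d0 : t ^+ 2 + a ^+ 2 != 0.
  by rewrite lt0r_neq0// ltr_pwDl ?sqr_ge0 ?exprn_gt0.
apply: (mulIf (subr_imag_neq0 _ a t0)); rewrite divfK ?subr_imag_neq0//.
case: z => p q /=; simpc.
by apply/eqP; rewrite eq_complex /=; apply/andP; split; apply/eqP; field.
Qed.

(** The imaginary part of the integrand is [0], and the evaluation of its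
    integral shows that the right-hand side is real. *)
Lemma integral_laplace_value {R : realType} (n k : nat) :
  (0 < k)%N -> (k < n)%N ->
  exists2 v : R,
    (\int[@lebesgue_measure R]_(t in `]0%R, +oo[) (t ^+ k * sin_laplace n t)%:E
     = v%:E)%E &
    v%:C = - \sum_(0 <= l < n.+1 | (2 * l != n)%N)
      residue n k l * (ln `|freq n l : R| -i* (pi / 2 * Num.sg (freq n l))).
Proof.
move=> k0 kn; set K := residue n k.
pose u l : R := complex.Re (K l); pose v l : R := complex.Im (K l).
have a0 l : (2 * l != n)%N -> (freq n l : R) != 0.
  by rewrite /freq -natrM subr_eq0 eqr_nat eq_sym.
have K0 : \sum_(0 <= l < n.+1 | (2 * l != n)%N) K l = 0.
  exact: sum_residue0.
have pf t : 0 < t -> (t ^+ k * sin_laplace n t)%:C =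
    \sum_(0 <= l < n.+1 | (2 * l != n)%N)
      ((u l * t - v l * freq n l) / (t ^+ 2 + freq n l ^+ 2) +i*
       ((v l * t + u l * freq n l) / (t ^+ 2 + freq n l ^+ 2))).
  move=> t0; rewrite laplace_partial_fractions//.
  by apply: eq_bigr => l _; rewrite div_imag_shift.
pose ReA : {additive R[i] -> R} := @complex.Re R.
pose ImA : {additive R[i] -> R} := @complex.Im R.
have Rint := @rational_FTC R _ (index_iota 0 n.+1) (fun l => 2 * l != n)%N
  u v (freq n) (fun t => t ^+ k * sin_laplace n t) a0.
have Iint := @rational_FTC R _ (index_iota 0 n.+1) (fun l => 2 * l != n)%N
  v (fun l => - u l) (freq n) (fun t => 0) a0.
eexists.
  apply: Rint.
  - by rewrite -[RHS](raddf0 ReA) -K0 raddf_sum.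
  - by move=> t /pf/(congr1 ReA); rewrite raddf_sum.
  - by move=> t t0; rewrite mulr_ge0 ?exprn_ge0 ?sin_laplace_ge0 ?ltW.
have e0 : 0 = - \sum_(0 <= l < n.+1 | (2 * l != n)%N)
    (v l * ln `|freq n l : R| + - u l * (pi / 2 * Num.sg (freq n l))).
  apply: EFin_inj; rewrite -Iint ?integral0//.
  - by rewrite -[RHS](raddf0 ImA) -K0 raddf_sum.
  - move=> t /pf/(congr1 ImA); rewrite raddf_sum => H; rewrite [LHS]H.
    by apply: eq_bigr => l _; rewrite mulNr opprK.
apply/eqP; rewrite eq_complex; apply/andP; split; apply/eqP.
- rewrite -[RHS]/(ReA _) (raddfN ReA) (raddf_sum ReA) [LHS]/=; congr (- _).
  apply: eq_bigr => l _.
  rewrite /u /v; case: (K l) => p q; simpc => /=; ring.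
- rewrite -[RHS]/(ImA _) (raddfN ImA) (raddf_sum ImA) [LHS]e0; congr (- _).
  apply: eq_bigr => l _.
  rewrite /u /v; case: (K l) => p q; simpc => /=; ring.
Qed.

Theorem mainTheorem1 (R : realType) (n m : nat)
    (m_ge2 : (2 <= m)%N) (m_le_n : (m <= n)%N) :
  (@lebesgue_measure R).-integrable `]0, +oo[
    (fun x : R => (sin x ^+ n / x ^+ m)%:E) /\
  (\int[@lebesgue_measure R]_(x in `]0, +oo[) (sin x ^+ n / x ^+ m))%:C =
  'i%C ^ (m%:Z - n%:Z + 1) / (2 ^+ n * (m - 1)`!%:R) *
  \sum_(0 <= l < n.+1 | (2 * l != n)%N)
    (-1) ^+ l * 'C(n, l)%:R * ((n%:Z - (2 * l)%:Z)%:~R) ^+ (m - 1)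
    * Clog ('i%C * ((2 * l)%:Z - n%:Z)%:~R) :> R[i].
Proof.
have iS := integrable_sin_quotient (R:=R) n m m_ge2 m_le_n; split=> //.
case: m m_ge2 m_le_n iS => [//|k] k1 kn iS; rewrite subn1 /=.
have [v Iv vE] := @integral_laplace_value R n k k1 kn.
have mD : measurable (`]0%R, +oo[ : set (measurableTypeR R)) by [].
have f0 : k`!%:R != 0 :> R[i] by rewrite pnatr_eq0 -lt0n fact_gt0.
have i0 : 'i%C != 0 :> R[i] by rewrite eq_complex/= oner_eq0 andbF.
have IE : k`!%:R * \int[@lebesgue_measure R]_(x in `]0, +oo[)
    (sin x ^+ n / x ^+ k.+1) = v.
  rewrite -RintegralZl// /Rintegral integral_sin_quotient_laplace// Iv//.
have {}IE : k`!%:R * (\int[@lebesgue_measure R]_(x in `]0, +oo[)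
    (sin x ^+ n / x ^+ k.+1))%:C = v%:C by rewrite -IE rmorphM rmorph_nat.
apply: (mulfI f0); rewrite IE vE -sumrN mulrA mulr_sumr.
apply: eq_bigr => l nl.
have a0 : (freq n l : R) != 0.
  by rewrite /freq -natrM subr_eq0 eqr_nat eq_sym.
have -> : ((2 * l)%:Z - n%:Z)%:~R = (- freq n l)%:C :> R[i].
  by rewrite intrB -!pmulrn /freq rmorphN rmorphB rmorphM !rmorph_nat natrM; ring.
have -> : (n%:Z - (2 * l)%:Z)%:~R = (freq n l)%:C :> R[i].
  by rewrite intrB -!pmulrn /freq rmorphB rmorphM !rmorph_nat natrM; ring.
rewrite Clog_imaginary ?oppr_eq0// normrN sgrN mulrN.
set a := freq n l; set L := ln _; set S := pi / 2 * _.
have -> : L -i* S = L%:C + 'i%C * (- S)%:C.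
  by simpc.
have -> : 'i%C ^ (k.+1%:Z - n%:Z + 1) = 'i%C ^+ k.+2 * 'i%C ^- n :> R[i].
  rewrite exprnN -[_ ^+ _]/(_ ^ (k.+2%:Z)) -expfzDr//; congr (_ ^ _).
  by rewrite -[k.+2]addn1 PoszD; ring.
have alg (x y z s p q r : R[i]) : x != 0 -> y != 0 -> z != 0 ->
    - ((x * y)^-1 * (s * (p * q)) * r) =
    z * (- 1 * p / y / (x * z)) * (s * q * r).
  by move=> x0 y0 z0; field; rewrite x0 y0 z0.
rewrite /residue -/a !exprMn !exprS ['i%C * ('i%C * _)]mulrA sqr_iC.
apply: alg; [by rewrite expf_neq0// pnatr_eq0|exact: expf_neq0|exact: f0].
Qed.
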